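(* Let $\Bbbk$ be a field of characteristic $0$. Let $H$ be a connected bipartite graph with vertex set $[m]=\{1,\dots,m\}$, where $m\ge3$, and let $G=H\circ K_1$ be its corona, with vertex set $[2m]$. Then $A_{\mathrm c}(G)$ does not have the weak Lefschetz property (WLP).
   Context: Graphs are finite and simple. The corona $H\circ K_1$ of a graph $H$ on $[m]$ is the graph with vertex set $[2m]$ and edge set $E(H)\cup\{\{i,m+i\}:1\le i\le m\}$. A vertex cover of a graph $G$ is a set of vertices meeting every edge. For a graph $G$ on $[n]$, let $R=\Bbbk[x_1,\dots,x_n]$ with the standard grading, $x_C=\prod_{i\in C}x_i$, $J(G)=(x_C : C\text{ a vertex cover of }G)\subset R$, and $A_{\mathrm c}(G)=R/\big((x_1^2,\dots,x_n^2)+J(G)\big)$. A standard graded Artinian $\Bbbk$-algebra $A=\bigoplus_i[A]_i$ has the WLP if there is a linear form $\ell\in[A]_1$ such that for every $i$ the multiplication map $\cdot\ell:[A]_i\to[A]_{i+1}$ is injective or surjective. *)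

(* Defs.v *)
From HB Require Import structures.
From mathcomp Require Import all_boot all_order all_algebra.
From mathcomp Require Import generic_quotient ring_quotient boolp.
From mathcomp Require Import mpoly.

Set Implicit Arguments.
Unset Strict Implicit.
Unset Printing Implicit Defensive.

Import GRing.Theory.

Local Open Scope ring_scope.
Local Open Scope quotient_scope.

(* The vertex set {1, ..., n} is rendered as 'I_n = {0, ..., n-1}. *)
Record sgraph (n : nat) := SGraph {
  adj :> rel 'I_n;
  adj_sym : ssrbool.symmetric adj;
  adj_irr : irreflexive adj
}.

(* Only used for n > 0: the graph on no vertices also satisfies it. *)
Definition connected n (G : sgraph n) : Prop :=
  forall u v : 'I_n, connect G u v.

Definition bipartite n (G : sgraph n) : Prop :=
  exists A : {set 'I_n}, forall u v, G u v -> (u \in A) != (v \in A).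

Definition vertex_cover n (G : sgraph n) (C : {set 'I_n}) : bool :=
  [forall u, forall v, G u v ==> (u \in C) || (v \in C)].

(* 'I_(m + m) is split into the vertices i (inl) and m + i (inr), for i < m. *)
Definition corona_rel m (H : sgraph m) : rel 'I_(m + m) :=
  fun u v => match split u, split v with
             | inl i, inl j => H i j
             | inl i, inr j | inr i, inl j => i == j
             | inr _, inr _ => false
             end.

Lemma corona_sym m (H : sgraph m) : ssrbool.symmetric (corona_rel H).
Proof.
move=> u v; rewrite /corona_rel.
by case: (split u) => i; case: (split v) => j //=; rewrite (adj_sym, eq_sym).
Qed.

Lemma corona_irr m (H : sgraph m) : irreflexive (corona_rel H).
Proof.
by move=> u; rewrite /corona_rel; case: (split u) => i //=; rewrite adj_irr.
Qed.

Definition corona m (H : sgraph m) : sgraph (m + m) :=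
  SGraph (corona_sym H) (corona_irr H).

(* MathComp's idealr only covers proper ideals, but J(G) is the unit ideal
   when G has no edges; hence this variant without 1 \notin I, whose quotients
   are commutative rings that may be trivial. *)
HB.mixin Record isAbsorbing (R : comNzRingType) (I : R -> bool) := {
  absorbing_subproof : forall a, {in I, forall u, a * u \in I}
}.

#[short(type="ideal")]
HB.structure Definition Ideal (R : comNzRingType) :=
  {I of GRing.ZmodClosed R I & isAbsorbing R I}.

Section RingQuotient.
Variables (R : comNzRingType) (I : ideal R).

Definition ring_quot := {ideal_quot I}.

HB.instance Definition _ := EqQuotient.on ring_quot.
HB.instance Definition _ := GRing.Zmodule.on ring_quot.

Definition proj (p : R) : ring_quot := \pi_{ideal_quot I} p.

Lemma projP a : exists p, a = proj p.
Proof. by exists (repr a); rewrite /proj reprK. Qed.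

Lemma eq_proj p q : proj p = proj q <-> p - q \in I.
Proof. by rewrite /proj Quotient.idealrBE; split=> [->|/eqP]. Qed.

Definition one_quot : ring_quot := proj 1.
Definition mul_quot (a b : ring_quot) : ring_quot := proj (repr a * repr b).

Lemma proj_mul : {morph proj : p q / p * q >-> mul_quot p q}.
Proof.
move=> p q; apply/eq_proj.
have eq_repr r : r - repr (proj r) \in I by apply/eq_proj; rewrite /proj reprK.
have -> : p * q - repr (proj p) * repr (proj q) =
    q * (p - repr (proj p)) + repr (proj p) * (q - repr (proj q)).
  by rewrite !mulrBr [q * p]mulrC [q * repr _]mulrC addrA subrK.
by rewrite rpredD // absorbing_subproof.
Qed.

Lemma proj_add : {morph proj : p q / p + q >-> p + q}.
Proof. by move=> p q; rewrite /proj raddfD. Qed.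

Lemma mul_quotA : associative mul_quot.
Proof.
move=> a b c; have [p ->] := projP a; have [q ->] := projP b.
by have [r ->] := projP c; rewrite -!proj_mul mulrA.
Qed.

Lemma mul_quotC : commutative mul_quot.
Proof. by move=> a b; rewrite /mul_quot mulrC. Qed.

Lemma mul_quot1 : left_id one_quot mul_quot.
Proof. by move=> a; have [p ->] := projP a; rewrite -proj_mul mul1r. Qed.

Lemma mul_quotDl : left_distributive mul_quot +%R.
Proof.
move=> a b c; have [p ->] := projP a; have [q ->] := projP b.
by have [r ->] := projP c; rewrite -!(proj_mul, proj_add) mulrDl.
Qed.

HB.instance Definition _ := GRing.Zmodule_isComPzRing.Build ring_quot
  mul_quotA mul_quotC mul_quot1 mul_quotDl.

Lemma proj_zmod : zmod_morphism proj.
Proof. by move=> p q; rewrite /proj raddfB. Qed.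

Lemma proj_monoid : monoid_morphism proj.
Proof. by split=> // p q; rewrite proj_mul. Qed.

HB.instance Definition _ := GRing.isZmodMorphism.Build R ring_quot proj proj_zmod.
HB.instance Definition _ := GRing.isMonoidMorphism.Build R ring_quot proj proj_monoid.

End RingQuotient.

Section IdealConstructions.
Variable R : comNzRingType.

(* The ideal generated by the g t such that P t. *)
Definition in_gen_ideal (T : finType) (P : pred T) (g : T -> R) : R -> bool :=
  fun p => `[< exists c : T -> R, p = \sum_(t | P t) c t * g t >].

Section Gen.
Variables (T : finType) (P : pred T) (g : T -> R).

Lemma gen_ideal_zmod : zmod_closed (in_gen_ideal P g).
Proof.
split=> [|p q /asboolP[c ->] /asboolP[d ->]]; apply/asboolP.
  by exists (fun=> 0); rewrite big1 // => t _; rewrite mul0r.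
exists (fun t => c t - d t); rewrite -sumrB.
by apply: eq_bigr => t _; rewrite mulrBl.
Qed.

Lemma gen_ideal_absorbing a :
  {in in_gen_ideal P g, forall u, a * u \in in_gen_ideal P g}.
Proof.
move=> u /asboolP[c ->]; apply/asboolP; exists (fun t => a * c t).
by rewrite mulr_sumr; apply: eq_bigr => t _; rewrite mulrA.
Qed.

HB.instance Definition _ := GRing.isZmodClosed.Build R (in_gen_ideal P g)
  gen_ideal_zmod.
HB.instance Definition _ := isAbsorbing.Build R (in_gen_ideal P g)
  gen_ideal_absorbing.

Definition gen_ideal : ideal R := Ideal.clone R (in_gen_ideal P g) _.

End Gen.

Definition in_add_ideal (I J : ideal R) : R -> bool :=
  fun p => `[< exists a b, [/\ a \in I, b \in J & p = a + b] >].

Section Add.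
Variables I J : ideal R.

Lemma add_ideal_zmod : zmod_closed (in_add_ideal I J).
Proof.
split=> [|p q /asboolP[a [b [aI bJ ->]]] /asboolP[c [d [cI dJ ->]]]]; apply/asboolP.
  by exists 0, 0; rewrite !rpred0 addr0.
by exists (a - c), (b - d); rewrite !rpredB //; split=> //; rewrite opprD addrACA.
Qed.

Lemma add_ideal_absorbing a :
  {in in_add_ideal I J, forall u, a * u \in in_add_ideal I J}.
Proof.
move=> u /asboolP[b [c [bI cJ ->]]]; apply/asboolP; exists (a * b), (a * c).
by rewrite !absorbing_subproof //; split=> //; rewrite mulrDr.
Qed.

HB.instance Definition _ := GRing.isZmodClosed.Build R (in_add_ideal I J)
  add_ideal_zmod.
HB.instance Definition _ := isAbsorbing.Build R (in_add_ideal I J)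
  add_ideal_absorbing.

Definition add_ideal : ideal R := Ideal.clone R (in_add_ideal I J) _.

End Add.

End IdealConstructions.

Section WeakLefschetz.
Variable A : comPzRingType.

(* gr i is the degree-i component of A; negative degrees are omitted since the
   component is zero there, so that multiplication is trivially injective. *)
Definition has_WLP (gr : nat -> A -> Prop) : Prop :=
  exists2 l : A, gr 1%N l &
    forall i : nat,
      (forall a b, gr i a -> gr i b -> l * a = l * b -> a = b) \/
      (forall b, gr i.+1 b -> exists2 a, gr i a & l * a = b).

End WeakLefschetz.

Section CoverAlgebra.
Variables (k : fieldType) (n : nat) (G : sgraph n).

Definition xset (C : {set 'I_n}) : {mpoly k[n]} := \prod_(i in C) 'X_i.

Definition square_ideal : ideal {mpoly k[n]} :=
  gen_ideal predT (fun i : 'I_n => 'X_i ^+ 2 : {mpoly k[n]}).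

Definition cover_ideal : ideal {mpoly k[n]} :=
  gen_ideal (vertex_cover G) xset.

Definition cover_algebra := ring_quot (add_ideal square_ideal cover_ideal).

HB.instance Definition _ := GRing.ComPzRing.on cover_algebra.

(* The standard grading: images of the homogeneous polynomials of degree i. *)
Definition cover_algebra_gr (i : nat) (a : cover_algebra) : Prop :=
  exists2 p : {mpoly k[n]}, p \is i.-homog &
    a = proj (add_ideal square_ideal cover_ideal) p.

End CoverAlgebra.

(* Main.v *)
(* Write m for the number of vertices of H. The weak Lefschetz property fails
   in degree m - 1, for every linear form l = sum_v a_v x_v.

   Injectivity fails. As H is bipartite, there is a cover S of its corona with m
   elements whose complement is also a cover. Weighting the squarefree monomials
   of degree m - 1 suitably by |T :&: S| gives b such that l b only involves the
   monomials of S and of its complement, both zero in the cover algebra; and b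
   is nonzero there since every cover has at least m elements. If l involves
   fewer than m - 1 variables, a multiple of their product is used instead.

   Surjectivity fails. The covers of the corona with m elements correspond to
   the covers of H, of which there are at most 2^(m-1) + 1, and this is at most
   the Catalan number 'C(2m, m) - 'C(2m, m - 1). So degree m has dimension at
   least that of degree m - 1, and surjectivity would imply injectivity. *)

Require Import Defs.
From mathcomp Require Import all_boot all_order all_algebra.
From mathcomp Require Import boolp mpoly ring zify.

Set Implicit Arguments.
Unset Strict Implicit.
Unset Printing Implicit Defensive.
Import GRing.Theory.

Lemma vertex_coverP n (G : sgraph n) (C : {set 'I_n}) :
  reflect (forall u v, G u v -> (u \in C) || (v \in C)) (vertex_cover G C).
Proof.
apply: (iffP forallP) => [cC u v uv|cC u]; first exact: implyP (forallP (cC u) v) uv.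
by apply/forallP=> v; apply/implyP/cC.
Qed.

Lemma vertex_coverS n (G : sgraph n) (S T : {set 'I_n}) :
  S \subset T -> vertex_cover G S -> vertex_cover G T.
Proof.
move=> /subsetP sub /vertex_coverP cS; apply/vertex_coverP => u v /cS.
by case/orP=> /sub ->; rewrite ?orbT.
Qed.

(** * Squarefree monomials and the defining ideal of the cover algebra *)

Section Squarefree.
Local Open Scope ring_scope.
Variables (k : fieldType) (n : nat).
Implicit Types (p q : {mpoly k[n]}) (S T W : {set 'I_n}) (mu nu : 'X_{1..n}).

Definition mset S : 'X_{1..n} := [multinom (i \in S : nat) | i < n].

Lemma xsetE S : xset k S = 'X_[mset S].
Proof.
rewrite mpolyXE_id /xset big_mkcond; apply: eq_bigr => i _.
by rewrite mnmE; case: (i \in S).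
Qed.

Lemma mdeg_mset S : mdeg (mset S) = #|S|.
Proof.
rewrite mdegE -sum1_card [RHS]big_mkcond; apply: eq_bigr => i _.
by rewrite mnmE; case: (i \in S).
Qed.

Lemma mset_inj : injective mset.
Proof.
move=> S T /mnmP eqST; apply/setP=> i; move: (eqST i); rewrite !mnmE.
by case: (i \in S); case: (i \in T).
Qed.

Lemma lep_mset S T : (mset S <= mset T)%MM = (S \subset T).
Proof.
apply/mnm_lepP/subsetP => [le i iS|sub i].
  by move: (le i); rewrite !mnmE iS; case: (i \in T).
by rewrite !mnmE; case: (boolP (i \in S)) => // /sub ->.
Qed.

Lemma mset_setD1 S v : v \in S -> (mset S - U_(v))%MM = mset (S :\ v).
Proof.
move=> vS; apply/mnmP=> i; rewrite mnmBE mnm1E !mnmE !inE eq_sym.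
by case: eqVneq => [->|_]; rewrite ?vS ?subn0.
Qed.

Lemma mcoeffMX_cond p mu nu :
  (p * 'X_[mu])@_nu = if (mu <= nu)%MM then p@_(nu - mu) else 0.
Proof.
case: ifPn => [le|nle]; first by rewrite -{1}(submK le) addmC mcoeffMX.
apply/eqP; rewrite mcoeff_eq0; apply: contra nle.
rewrite (perm_mem (msuppMX p mu)) => /mapP[w _ ->].
by apply/mnm_lepP => i; rewrite mnmDE leq_addr.
Qed.

Lemma homog1E p : p \is 1.-homog -> p = \sum_v p@_U_(v) *: 'X_v.
Proof.
move=> hp; apply/mpolyP=> mu; rewrite raddf_sum /=.
have [/mdeg1P[v /eqP ->]|nmu] := boolP (mdeg mu == 1%N); last first.
  rewrite (dhomog_nemf_coeff hp nmu) big1 // => v _.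
  rewrite mcoeffZ mcoeffX; case: eqP => [e|]; last by rewrite mulr0.
  by rewrite -e mdeg1 in nmu.
rewrite (bigD1 v) //= mcoeffZ mcoeffXU eqxx mulr1 big1 ?addr0 // => w /negbTE wv.
by rewrite mcoeffZ mcoeffXU wv mulr0.
Qed.

Lemma mcoeff_linM l p W : l \is 1.-homog ->
  (l * p)@_(mset W) = \sum_(v in W) l@_U_(v) * p@_(mset (W :\ v)).
Proof.
move=> hl; rewrite {1}(homog1E hl) mulr_suml raddf_sum [RHS]big_mkcond /=.
apply: eq_bigr => v _; rewrite -scalerAl ['X_v * p]mulrC mcoeffZ mcoeffMX_cond.
have -> : (U_(v) <= mset W)%MM = (v \in W).
  have -> : U_(v)%MM = mset [set v].
    by apply/mnmP=> i; rewrite mnm1E mnmE inE eq_sym.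
  by rewrite lep_mset sub1set.
by case: ifP => vW; rewrite ?mulr0 // mset_setD1.
Qed.

Section Ideal.
Variable G : sgraph n.

Let I := add_ideal (square_ideal k n) (cover_ideal k G).

(** No ['X_i ^+ 2] divides a squarefree monomial, and [xset k C] divides the monomial of [S] only if
    [C \subset S], which would make [S] a cover. With the converse below, the squarefree monomials
    of non-covers form a basis of the cover algebra. *)
Lemma mcoeff_cover_ideal p S : p \in I -> ~~ vertex_cover G S -> p@_(mset S) = 0.
Proof.
move=> /asboolP[a [b [/asboolP[c ->] /asboolP[d ->] ->]]] ncS.
rewrite mcoeffD !raddf_sum /= !big1 ?addr0 // => [C cC|i _].
  rewrite xsetE mcoeffMX_cond lep_mset ifF //.
  by apply: contraNF ncS => /vertex_coverS; apply.
rewrite mpolyXn mcoeffMX_cond ifF //; apply/negbTE/mnm_lepP => /(_ i).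
by rewrite mulmnE mnm1E eqxx mnmE; case: (i \in S).
Qed.

(** Term by term: a monomial of [p] either has an exponent of at least 2, or is squarefree with a
    support that must be a cover. *)
Lemma mem_cover_ideal p :
  (forall S, ~~ vertex_cover G S -> p@_(mset S) = 0) -> p \in I.
Proof.
move=> p0; rewrite (mpolyE p) big_seq rpred_sum // => mu; rewrite mcoeff_msupp => nz.
rewrite -mul_mpolyC; apply: absorbing_subproof.
have [/existsP[i mui]|sqf] := boolP [exists i, 1 < mu i]%N.
  apply/asboolP; exists 'X_[mu], 0; rewrite rpred0 addr0; split=> //.
  have le : (U_(i) *+ 2 <= mu)%MM.
    by apply/mnm_lepP=> j; rewrite mulmnE mnm1E; case: eqVneq => [<-|].
  rewrite -(submK le) mpolyXD -mpolyXn; apply: absorbing_subproof.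
  apply/asboolP; exists (fun j => (j == i)%:R).
  by rewrite (bigD1 i) //= eqxx mul1r big1 ?addr0 // => j /negbTE ->; rewrite mul0r.
have eqmu : mu = mset [set i | 0 < mu i]%N.
  apply/mnmP=> i; rewrite mnmE inE; move: sqf; rewrite negb_exists => /forallP/(_ i).
  by case: (mu i) => [|[]].
rewrite eqmu in nz *; case: (boolP (vertex_cover G [set i | 0 < mu i]%N)) => [c|/p0 e].
  apply/asboolP; exists 0, 'X_[mset [set i | 0 < mu i]%N]; rewrite rpred0 add0r; split=> //.
  apply/asboolP; exists (fun C => (C == [set i | 0 < mu i]%N)%:R).
  rewrite (bigD1 [set i | 0 < mu i]%N) //= eqxx mul1r -xsetE big1 ?addr0 //.
  by move=> C /andP[_ /negbTE ->]; rewrite mul0r.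
by rewrite e eqxx in nz.
Qed.

End Ideal.
End Squarefree.

(** * Bounds on the number of covers and on central binomial coefficients *)

(* U and its complement are both covers only for the parts U of a bipartition,
   and a connected graph has at most one bipartition. *)
Lemma card_vertex_cover m (H : sgraph m) : connected H ->
  #|[set U | vertex_cover H U]|.*2 <= 2 ^ m + 2.
Proof.
move=> Hconn; set I := [set U | _]; pose J := @setC _ @: I.
(* Complementation is injective, so [J] has as many elements as [I]; the union contributes at most
   [2 ^ m] and the intersection at most 2. *)
have -> : #|I|.*2 = #|I :|: J| + #|I :&: J|.
  by rewrite cardsUI (card_imset _ (inv_inj (@setCK _))) addnn.
have memI U : U \in I :&: J -> vertex_cover H U /\ vertex_cover H (~: U).
  rewrite inE => /andP[]; rewrite inE => -> /imsetP[V].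
  by rewrite inE => ? ->; rewrite setCK.
apply: leq_add.
  apply: leq_trans (max_card _) _.
  by rewrite -cardsT -powersetT card_powerset cardsT card_ord.
have [-> | [U /memI[/vertex_coverP c1 /vertex_coverP c2]]] := set_0Vmem (I :&: J).
  by rewrite cards0.
apply: leq_trans (subset_leq_card _) (_ : #|[set U; ~: U]| <= 2); last first.
  by rewrite cards2; case: eqP.
apply/subsetP => V /memI[/vertex_coverP d1 /vertex_coverP d2].
(* Every edge has exactly one end in [U] and one in [V], so whether [U] and [V] agree at a vertex is
   constant along edges. *)
have alt (x y : 'I_m) : connect H x y ->
    ((x \in U) == (x \in V)) = ((y \in U) == (y \in V)).
  apply: (@closed_connect _ _ [pred z | (z \in U) == (z \in V)]) => {x y} x y xy.
  rewrite !inE; move: (c1 _ _ xy) (c2 _ _ xy) (d1 _ _ xy) (d2 _ _ xy); rewrite !inE.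
  by case: (x \in U); case: (y \in U); case: (x \in V); case: (y \in V).
(* The empty graph is treated apart, since it has no base vertex [ord0] at which to compare [U] and
   [V]. *)
rewrite !inE; case: m H Hconn @I @J memI U c1 c2 V d1 d2 alt
  => [|m] H Hconn I J memI U c1 c2 V d1 d2 alt.
  by apply/orP; left; apply/eqP/setP => -[].
case e : ((ord0 \in U) == (ord0 \in V)); apply/orP; [left|right];
  apply/eqP/setP => y; move: (alt ord0 y (Hconn _ _)); rewrite e ?inE.
  by move/esym/eqP.
by case: (y \in U); case: (y \in V).
Qed.

(** Induction with 'C(2m+2, m+1) = 2 'C(2m+1, m) and (m+1) 'C(2m+1, m) = (2m+1) 'C(2m, m). At m = 3
    both sides equal 20. *)
Lemma central_bin_bound m : 3 <= m -> m.+1 * (2 ^ m.-1).+1 <= 'C(m + m, m).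
Proof.
elim: m => // m IH; rewrite leq_eqVlt => /predU1P[[<-]|]; first by [].
rewrite ltnS => m3; have {IH} := IH m3.
have := mul_bin_diag (m.+1 + m.+1) m; rewrite addSn addnS /= => e1.
have := mul_bin_down (m + m).+1 m; rewrite /= subSn ?leq_addr // addnK => e2 IH.
have {}e1 : 'C((m + m).+2, m.+1) = 2 * 'C((m + m).+1, m).
  by apply/eqP; rewrite -(eqn_pmul2l (ltn0Sn m)) -e1; apply/eqP; ring.
have IH' : (m + m).+1 * (2 ^ m.-1).+1 <= 'C((m + m).+1, m).
  by rewrite -(leq_pmul2l (ltn0Sn m)) -e2 mulnCA leq_mul2l IH orbT.
rewrite e1; have -> : 2 ^ m = 2 * 2 ^ m.-1 by case: (m) m3 => // q _; rewrite expnS.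
by nia.
Qed.

(** Since m 'C(2m, m) = (m+1) 'C(2m, m-1), the difference of the two binomials is the Catalan number
    'C(2m, m) / (m+1). *)
Lemma bin_middle_bound m : 3 <= m ->
  'C(m + m, m.-1) + (2 ^ m.-1).+1 <= 'C(m + m, m).
Proof.
move=> m3; have := central_bin_bound m3; have := mul_bin_left (m + m) m.-1.
case: m m3 => // m _ /=.
have -> : m.+1 + m.+1 - m = m.+2 by lia.
by nia.
Qed.

(** * Minimum vertex covers of the corona *)

Section Corona.
Variables (m : nat) (H : sgraph m).
Implicit Types (C : {set 'I_(m + m)}) (U : {set 'I_m}).

Definition base C : {set 'I_m} := [set i | lshift m i \in C].

(** The sets of this form are the transversals of the perfect matching formed by the pendant
    edges. *)
Definition whisker U : {set 'I_(m + m)} :=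
  [set v | match split v with inl i => i \in U | inr i => i \notin U end].

Lemma lshift_whisker U i : (lshift m i \in whisker U) = (i \in U).
Proof. by rewrite inE (unsplitK (inl i)). Qed.

Lemma rshift_whisker U i : (rshift m i \in whisker U) = (i \notin U).
Proof. by rewrite inE (unsplitK (inr i)). Qed.

Lemma whiskerC U : ~: whisker U = whisker (~: U).
Proof. by apply/setP=> v; rewrite !inE; case: (split v) => i; rewrite inE. Qed.

Lemma card_shifts C : #|C| = \sum_i ((lshift m i \in C) + (rshift m i \in C)).
Proof.
rewrite -sum1_card big_mkcond big_split_ord [RHS]big_split /=.
by congr (_ + _); apply: eq_bigr => i _; case: (_ \in C).
Qed.

Lemma card_whisker U : #|whisker U| = m.
Proof.
rewrite card_shifts (eq_bigr (fun=> 1)) => [|i _]; first by rewrite sum1_card card_ord.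
by rewrite lshift_whisker rshift_whisker; case: (i \in U).
Qed.

Lemma cover_base C : vertex_cover (corona H) C -> vertex_cover H (base C).
Proof.
move=> /vertex_coverP cC; apply/vertex_coverP => i j ij; rewrite !inE; apply: cC.
by rewrite /= /corona_rel (unsplitK (inl i)) (unsplitK (inl j)).
Qed.

Lemma cover_shift C i : vertex_cover (corona H) C ->
  (lshift m i \in C) || (rshift m i \in C).
Proof.
move=> /vertex_coverP; apply.
by rewrite /= /corona_rel (unsplitK (inl i)) (unsplitK (inr i)).
Qed.

Lemma cover_whisker U : vertex_cover H U -> vertex_cover (corona H) (whisker U).
Proof.
move=> /vertex_coverP cU; apply/vertex_coverP => u v.
rewrite /= /corona_rel !inE; case: (split u) => i; case: (split v) => j //.
- exact: cU.
- by move/eqP->; rewrite orbN.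
- by move/eqP->; rewrite orNb.
Qed.

(** A cover meets each of the [m] disjoint pendant edges; equality means that it contains exactly
    one end of each. *)
Lemma card_cover_leqif C : vertex_cover (corona H) C ->
  m <= #|C| ?= iff (C == whisker (base C)).
Proof.
move=> cC; rewrite card_shifts -[X in X <= _ ?= iff _]card_ord -sum1_card.
have -> : (C == whisker (base C)) =
    [forall i, (1 == (lshift m i \in C) + (rshift m i \in C))].
  apply/eqP/forallP => [-> i|h].
    by rewrite lshift_whisker rshift_whisker inE; case: (_ \in C).
  apply/setP => v; rewrite -(splitK v); case: (split v) => i; move: (h i) => /=.
    by rewrite lshift_whisker inE.
  by rewrite rshift_whisker inE; do 2?case: (_ \in C).
apply: leqif_sum => i _; split=> //.
by move: (cover_shift i cC); do 2?case: (_ \in C).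
Qed.

(** By the equality case above, a cover with [m] elements is recovered from its base. *)
Lemma card_min_cover :
  #|[set C | vertex_cover (corona H) C & #|C| == m]| <=
    #|[set U | vertex_cover H U]|.
Proof.
rewrite -(card_in_imset (f := base)) => [|C D].
  apply/subset_leq_card/subsetP => U /imsetP[C].
  by rewrite !inE => /andP[cC _] ->; apply: cover_base.
rewrite !inE => /andP[cC /eqP eC] /andP[cD /eqP eD] e.
have /eqP -> : C == whisker (base C) by rewrite -(card_cover_leqif cC).2 eC.
by rewrite e; apply/esym/eqP; rewrite -(card_cover_leqif cD).2 eD.
Qed.

Lemma card_noncover : 3 <= m -> connected H ->
  #|[set T : {set 'I_(m + m)} | #|T| == m.-1]| <=
  #|[set W | ~~ vertex_cover (corona H) W & #|W| == m]|.
Proof.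
move=> m3 Hconn; have cardD d : #|[set T : {set 'I_(m + m)} | #|T| == d]| = 'C(m + m, d).
  by rewrite card_draws card_ord.
rewrite cardD; have := bin_middle_bound m3; rewrite -(cardD m).
have := card_vertex_cover Hconn; have := card_min_cover.
rewrite -(cardsID [set C | vertex_cover (corona H) C] [set T : {set 'I_(m + m)} | #|T| == m]).
have -> : [set T : {set 'I_(m + m)} | #|T| == m] :&: [set C | vertex_cover (corona H) C] =
  [set C | vertex_cover (corona H) C & #|C| == m].
  by apply/setP=> C; rewrite !inE andbC.
have -> : [set T : {set 'I_(m + m)} | #|T| == m] :\: [set C | vertex_cover (corona H) C] =
  [set W | ~~ vertex_cover (corona H) W & #|W| == m].
  by apply/setP=> C; rewrite !inE.
have : 2 ^ m = (2 ^ m.-1).*2 by case: (m) m3 => // q _; rewrite expnS mul2n.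
by lia.
Qed.

End Corona.

(** * Multiplication by a linear form on squarefree coefficients *)

Section LefschetzDegree.
Local Open Scope ring_scope.
Variables (k : fieldType) (n : nat).
Implicit Types (l p : {mpoly k[n]}) (S T W : {set 'I_n}).

Definition sqpoly (d : nat) (u : {set 'I_n} -> k) : {mpoly k[n]} :=
  \sum_(T : {set 'I_n} | #|T| == d) u T *: 'X_[mset T].

Lemma homog_sqpoly d u : sqpoly d u \is d.-homog.
Proof.
apply: rpred_sum => T /eqP dT; apply: rpredZ; rewrite dhomogX.
by apply/eqP; rewrite -dT; apply: mdeg_mset.
Qed.

Lemma mcoeff_sqpoly d u T : (sqpoly d u)@_(mset T) = if #|T| == d then u T else 0.
Proof.
rewrite raddf_sum /=; case: ifP => dT; last first.
  rewrite big1 // => W dW; rewrite mcoeffZ mcoeffX (inj_eq (@mset_inj n)).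
  by case: eqP => [e|]; rewrite ?mulr0 // -e dW in dT *.
rewrite (bigD1 T) //= mcoeffZ mcoeffX eqxx mulr1 big1 ?addr0 // => W /andP[_ /negbTE nW].
by rewrite mcoeffZ mcoeffX (inj_eq (@mset_inj n)) nW mulr0.
Qed.

(** Applied to the support [A] of a linear form, this separates large supports from small ones. *)
Lemma exists_comparable_set (A : {set 'I_n}) d : (d <= n)%N ->
  exists2 T : {set 'I_n}, #|T| = d & (T \subset A) || (A \subset T).
Proof.
move=> dn; have draw (B : {set 'I_n}) e : (e <= #|B|)%N ->
    exists2 T : {set 'I_n}, #|T| = e & T \subset B.
  rewrite -bin_gt0 -cards_draws card_gt0 => /set0Pn[T].
  by rewrite inE => /andP[TB /eqP eT]; exists T.
have [/draw[T eT TA]|/ltnW Ad] := leqP d #|A|; first by exists T; rewrite ?TA.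
have cA := cardsC A; rewrite card_ord in cA.
have [|T eT TA] := draw (~: A) (n - d)%N; first by lia.
exists (~: T); last by rewrite subsetC TA orbT.
by have := cardsC T; rewrite card_ord; lia.
Qed.

(** Up to the factor (m-1)!, this is (-1)^j / 'C(m-1, j), a solution of the two-term recurrence
    below. *)
Definition kernel_coef (m j : nat) : k := (-1) ^+ j * (j`! * (m.-1 - j)`!)%:R.

Lemma kernel_coef_rec m j : (0 < j < m)%N ->
  kernel_coef m j.-1 *+ j + kernel_coef m j *+ (m - j) = 0.
Proof.
case: j => // j /= jm; rewrite /kernel_coef -!mulrnAr -!mulrnA.
have [-> ->] : (m.-1 - j = (m.-1 - j.+1).+1)%N /\ (m - j.+1 = (m.-1 - j.+1).+1)%N.
  by lia.
rewrite (_ : (_ * _ * j.+1 = j.+1`! * (m.-1 - j.+1)`! * (m.-1 - j.+1).+1)%N).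
  by rewrite exprS mulN1r mulNr subrr.
by rewrite !factS; ring.
Qed.

(** The product of all [a w] over [W] factors out. With j = [#|W :&: S|], removing [v] leaves j - 1
    elements of [S] in j cases and j in the other m - j, so [kernel_coef_rec] applies. Its condition
    0 < j < m excludes exactly [~: S] and [S]. *)
Lemma mul_kernel_sum m S W (a : 'I_n -> k) : #|S| = m -> #|~: S| = m ->
    W != S -> W != ~: S -> #|W| = m ->
  \sum_(v in W) a v * (kernel_coef m #|(W :\ v) :&: S| * \prod_(w in W :\ v) a w) = 0.
Proof.
move=> cS cCS WS WCS cW.
have -> : \sum_(v in W) a v * (kernel_coef m #|(W :\ v) :&: S| * \prod_(w in W :\ v) a w) =
    \prod_(w in W) a w * \sum_(v in W) kernel_coef m #|(W :\ v) :&: S|.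
  rewrite mulr_sumr; apply: eq_bigr => v vW.
  by rewrite [\prod_(w in W) _](big_setD1 v) //= mulrCA mulrC.
suff -> : \sum_(v in W) kernel_coef m #|(W :\ v) :&: S| = 0 by rewrite mulr0.
rewrite (big_setID S) /=.
have cWS := cardsID S W.
rewrite (eq_bigr (fun=> kernel_coef m #|W :&: S|.-1)) => [|v /setIP[vW vS]]; last first.
  by rewrite setIDAC (cardsD1 v (W :&: S)) inE vW vS.
rewrite [X in _ + X](eq_bigr (fun=> kernel_coef m #|W :&: S|))
  => [|v /setDP[vW vS]]; last first.
  rewrite setIDAC; congr (kernel_coef _ #|pred_of_set _|); apply/setDidPl.
  by rewrite disjoint_sym disjoints1 inE (negbTE vS) andbF.
rewrite !sumr_const.
have -> : #|W :\: S| = (m - #|W :&: S|)%N by lia.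
rewrite kernel_coef_rec //; apply/andP; split.
  rewrite card_gt0; apply: contra WCS => /eqP WS0.
  by rewrite eqEcard cCS cW leqnn andbT subsets_disjoint setCK -setI_eq0 WS0.
rewrite ltnNge; apply: contra WS => mWS.
have /eqP e : W :&: S == W by rewrite eqEcard subsetIl cW.
by rewrite eqEcard cS cW leqnn andbT; apply/setIidPl.
Qed.

Lemma exists_kernel_poly m S l : [pchar k] =i pred0 -> (0 < m)%N ->
    #|S| = m -> #|~: S| = m -> l \is 1.-homog ->
  exists2 p : {mpoly k[n]}, p \is m.-1.-homog &
    (exists2 T : {set 'I_n}, #|T| = m.-1 & p@_(mset T) != 0) /\
    (forall W, W != S -> W != ~: S -> (l * p)@_(mset W) = 0).
Proof.
move=> hk m0 cS cCS hl; pose a v := l@_U_(v).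
have nm : (m.-1 <= n)%N by have := cardsC S; rewrite card_ord; lia.
have [T cT /orP[TA|AT]] := exists_comparable_set [set v | a v != 0] nm.
  exists (sqpoly m.-1 (fun T => kernel_coef m #|T :&: S| * \prod_(v in T) a v)).
    exact: homog_sqpoly.
  split=> [|W WS WCS].
    exists T; rewrite // mcoeff_sqpoly cT eqxx mulf_neq0 //; last first.
      by apply/prodf_neq0 => v /(subsetP TA); rewrite inE.
    (* Characteristic 0 keeps the factorials nonzero in [k]. *)
    rewrite mulf_neq0 ?signr_eq0 //; move/pcharf0P: hk => ->.
    by rewrite -lt0n muln_gt0 !fact_gt0.
  rewrite mcoeff_linM //; have [cW|ncW] := eqVneq #|W| m; last first.
    rewrite big1 // => v vW; rewrite mcoeff_sqpoly ifF ?mulr0 //.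
    by apply: contraNF ncW => /eqP; rewrite (cardsD1 v W) vW => ->; rewrite add1n prednK.
  rewrite -[RHS](mul_kernel_sum a cS cCS WS WCS cW).
  apply: eq_bigr => v vW; rewrite mcoeff_sqpoly ifT //.
  by rewrite -cW (cardsD1 v W) vW.
(* Every variable of [l] now divides the monomial of [T], so no term of the product with [l] is
   squarefree. *)
exists 'X_[mset T]; first by rewrite dhomogX; apply/eqP; rewrite -cT; apply: mdeg_mset.
split=> [|W _ _]; first by exists T; rewrite // mcoeffX eqxx oner_eq0.
rewrite mcoeff_linM // big1 // => v vW; rewrite mcoeffX (inj_eq (@mset_inj n)).
case: eqP => [e|]; last by rewrite mulr0.
have : v \notin T by rewrite e !inE eqxx.
by move/(contra (subsetP AT v)); rewrite inE negbK => /eqP; rewrite /a => ->; rewrite mul0r.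
Qed.

(** Multiplication by [l] acts on row vectors of squarefree coefficients through a matrix with at
    least as many columns as rows; full column rank then forces its rows to be independent. *)
Lemma lin_surj_inj (G : sgraph n) l d :
    l \is 1.-homog ->
    (#|[set T : {set 'I_n} | #|T| == d]| <=
       #|[set W | ~~ vertex_cover G W & #|W| == d.+1]|)%N ->
    (forall q : {mpoly k[n]}, q \is d.+1.-homog ->
       exists2 p : {mpoly k[n]}, p \is d.-homog &
       forall W, ~~ vertex_cover G W -> (l * p)@_(mset W) = q@_(mset W)) ->
  forall p, (forall W, ~~ vertex_cover G W -> (l * p)@_(mset W) = 0) ->
  forall T, #|T| = d -> p@_(mset T) = 0.
Proof.
move=> hl; set D1 := [set T : {set 'I_n} | _]; set D2 := [set W | _ & _] => le12 surj.
pose e1 (i : 'I_#|D1|) : {set 'I_n} := enum_val i.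
pose e2 (j : 'I_#|D2|) : {set 'I_n} := enum_val j.
pose M : 'M[k]_(#|D1|, #|D2|) := \matrix_(i, j)
  \sum_(v in e2 j) l@_U_(v) * (e1 i == e2 j :\ v)%:R.
pose u p : 'rV[k]_#|D1| := \row_i p@_(mset (e1 i)).
have uM p j : (u p *m M) 0 j = (l * p)@_(mset (e2 j)).
  rewrite mxE mcoeff_linM //.
  under eq_bigr => i _ do rewrite !mxE mulr_sumr.
  rewrite exchange_big /=; apply: eq_bigr => v vj.
  have vD1 : e2 j :\ v \in D1.
    have := enum_valP j; rewrite !inE => /andP[_].
    by rewrite (cardsD1 v) vj.
  have [i0 ei0] : exists i0, e1 i0 = e2 j :\ v.
    by exists (enum_rank_in vD1 (e2 j :\ v)); rewrite /e1 enum_rankK_in.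
  rewrite (bigD1 i0) //= ei0 eqxx mulr1 mulrC big1 ?addr0 // => i ni.
  by rewrite -ei0 (inj_eq enum_val_inj) (negbTE ni) !mulr0.
have Mfull : row_full M.
  (* Each unit row vector is hit, by a preimage of the corresponding monomial. *)
  rewrite -sub1mx; apply/row_subP => j; apply/submxP.
  have := enum_valP j; rewrite inE => /andP[ncj /eqP cj].
  have [|p _ ep] := surj 'X_[mset (e2 j)].
    by rewrite dhomogX; apply/eqP; rewrite -cj; apply: mdeg_mset.
  exists (u p); apply/rowP => j'; rewrite uM !mxE ep; last first.
    by have := enum_valP j'; rewrite inE => /andP[].
  by rewrite mcoeffX (inj_eq (@mset_inj n)) (inj_eq enum_val_inj).
have Mfree : row_free M.
  by rewrite -row_leq_rank (eqP Mfull).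
move=> p p0 T cT.
have /rowP up0 : u p = 0.
  apply: (row_free_inj Mfree); rewrite mul0mx; apply/rowP => j; rewrite uM mxE p0 //.
  by have := enum_valP j; rewrite inE => /andP[].
have TD : T \in D1 by rewrite inE cT.
by move: (up0 (enum_rank_in TD T)); rewrite !mxE /e1 enum_rankK_in.
Qed.

End LefschetzDegree.

Theorem corollary6p5 (k : fieldType) (hk : [pchar k]%R =i pred0)
    (m : nat) (hm : 3 <= m) (H : sgraph m)
    (Hconn : connected H) (Hbip : bipartite H) :
  ~ has_WLP (cover_algebra_gr (k := k) (G := corona H)).
Proof.
case=> _ [l hl ->] /(_ m.-1).
have m0 : 0 < m by apply: leq_trans hm.
have [P bipP] := Hbip; have coverP (U : {set 'I_m}) :
    (forall i j, H i j -> (i \in U) != (j \in U)) -> vertex_cover (corona H) (whisker U).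
  move=> bipU; apply/cover_whisker/vertex_coverP => i j /bipU.
  by case: (i \in U) => //; case: (j \in U).
have cP := coverP _ bipP.
(* The complement comes from the other part of the bipartition. *)
have cCP : vertex_cover (corona H) (~: whisker P).
  rewrite whiskerC; apply: coverP => i j /bipP.
  by rewrite !inE; case: (i \in P); case: (j \in P).
have cardCP : #|~: whisker P| = m by rewrite whiskerC card_whisker.
have [p hp [[T cT pT] lp]] := exists_kernel_poly hk m0 (card_whisker P) cardCP hl.
have {}lp W : ~~ vertex_cover (corona H) W -> ((l * p)@_(mset W) = 0)%R.
  by move=> ncW; apply: lp; apply: contraNneq ncW => ->.
have ncT : ~~ vertex_cover (corona H) T.
  by apply/negP => /card_cover_leqif[le _]; move: le; rewrite cT; lia.
case=> [inj | surj].
  (* Both [p] and 0 are sent to 0 by [l], so injectivity would put [p] in the ideal, against its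
     nonzero coefficient at the non-cover [T]. *)
  have /eq_proj : proj (add_ideal (square_ideal k _) (cover_ideal k (corona H))) p = proj _ 0%R.
    apply: inj; [by exists p | by exists 0%R => //; apply: dhomog0 |].
    rewrite -!rmorphM mulr0; apply/eq_proj; rewrite subr0.
    exact: mem_cover_ideal.
  rewrite subr0 => /mcoeff_cover_ideal/(_ ncT) pT0.
  by rewrite pT0 eqxx in pT.
have le12 : #|[set S : {set 'I_(m + m)} | #|S| == m.-1]| <=
    #|[set W | ~~ vertex_cover (corona H) W & #|W| == m.-1.+1]|.
  by rewrite prednK //; apply: card_noncover.
(* Equality in the quotient is read off on the coefficients of non-covers. *)
have surj' (q : {mpoly k[m + m]}) : q \is m.-1.+1.-homog ->
    exists2 r : {mpoly k[m + m]}, r \is m.-1.-homog &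
    forall W, ~~ vertex_cover (corona H) W -> ((l * r)@_(mset W) = q@_(mset W))%R.
  move=> hq; have [|_ [r hr ->]] := surj (proj _ q); first by exists q.
  rewrite -rmorphM => /eq_proj e; exists r => // W ncW.
  by apply/eqP; rewrite -subr_eq0 -mcoeffB; apply/eqP/(mcoeff_cover_ideal e).
by rewrite (lin_surj_inj hl le12 surj' lp cT) eqxx in pT.
Qed.
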